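(* Let $n\ge 2$, let $m_1\ge m_2\ge\cdots\ge m_n$ be positive integers, and let $\tilde{\mathcal A}$ be a multi-arrangement of $n$ points in $\mathbb{CP}^1$ with multiplicities $m_1,\ldots,m_n$, with defining polynomial $$\tilde Q=x^{m_1}y^{m_2}\prod_{i=3}^n(x-z_iy)^{m_i},$$ where $z_3,\ldots,z_n\in\mathbb C\setminus\{0\}$ are pairwise distinct. Suppose $m_1\ge\sum_{i=2}^n m_i$. Then the derivation $\theta_1=\frac{\tilde Q}{x^{m_1}}\,\partial_y$ belongs to $D(\tilde{\mathcal A})$ and has minimal degree among the nonzero homogeneous elements of $D(\tilde{\mathcal A})$. In particular, the exponents of $\tilde{\mathcal A}$ are $$(e_1,e_2)=\left(\sum_{i=2}^n m_i,\ m_1\right).$$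
   Context: Let $S=\mathbb C[x,y]$. A multi-arrangement $\tilde{\mathcal A}$ in $\mathbb{CP}^1$ is a set of $n\geq 2$ pairwise distinct points $p_1,\ldots,p_n$ of $\mathbb{CP}^1$ together with positive integer multiplicities $m_1,\ldots,m_n$; with linear forms $\alpha_i$ such that $\ker\alpha_i=p_i$, its defining polynomial is $\prod_i\alpha_i^{m_i}$. (Any multi-arrangement can be brought into the form in the claim, $\alpha_1=x$, $\alpha_2=y$, $\alpha_i=x-z_iy$ for $i\ge3$, by a choice of coordinates.) Its module of derivations is the graded $S$-module $$D(\tilde{\mathcal A})=\{\theta\in \mathrm{Der}_{\mathbb C}(S)\mid \theta(\alpha_i)\in\alpha_i^{m_i}S\ \text{ for all } i\}.$$ A nonzero derivation $f\partial_x+g\partial_y$ is homogeneous of degree $d$ if $f$ and $g$ are each zero or homogeneous polynomials of degree $d$. The module $D(\tilde{\mathcal A})$ is always free of rank 2 with a homogeneous basis; the degrees $e_1\le e_2$ of the elements of a homogeneous basis are uniquely determined, and $(e_1,e_2)$ is called the exponents of $\tilde{\mathcal A}$. *)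

(* Defs.v *)
From HB Require Import structures.
From mathcomp Require Import all_boot all_order all_algebra.
From mathcomp Require Import mpoly.

Set Implicit Arguments.
Unset Strict Implicit.
Unset Printing Implicit Defensive.

Import GRing.Theory.
Local Open Scope ring_scope.

(* The variables x and y of K[x,y] are 'X_0 and 'X_1 in {mpoly K[2]}. *)

(* The points of P^1(K) are the kernels of the linear forms, so [lin_form_inj]
   says that the points are pairwise distinct. *)
Record multiarrangement (K : fieldType) (n : nat) := MultiArrangement {
  lin_form : 'I_n -> {mpoly K[2]};
  multiplicity : 'I_n -> nat;
  lin_form_homog : forall i, lin_form i \is 1.-homog;
  lin_form_neq0 : forall i, lin_form i != 0;
  lin_form_inj : forall i j,
    (forall v : 'I_2 -> K, (lin_form i).@[v] = 0 <-> (lin_form j).@[v] = 0) -> i = j;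
  multiplicity_gt0 : forall i, (0 < multiplicity i)%N
}.

Definition defining_poly (K : fieldType) (n : nat)
    (A : multiarrangement K n) : {mpoly K[2]} :=
  \prod_(i < n) lin_form A i ^+ multiplicity A i.

Definition derivation (K : fieldType)
    (theta : {mpoly K[2]} -> {mpoly K[2]}) : Prop :=
  linear theta /\ forall p q, theta (p * q) = theta p * q + p * theta q.

Definition in_D (K : fieldType) (n : nat) (A : multiarrangement K n)
    (theta : {mpoly K[2]} -> {mpoly K[2]}) : Prop :=
  derivation theta /\
  forall i, exists q, theta (lin_form A i) = lin_form A i ^+ multiplicity A i * q.

(* For a derivation theta = f d/dx + g d/dy one has f = theta x and
   g = theta y; note that 0 is d-homogeneous for every d. *)
Definition nonzero_homog (K : fieldType) (d : nat)
    (theta : {mpoly K[2]} -> {mpoly K[2]}) : Prop :=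
  (exists p, theta p != 0) /\ forall i : 'I_2, theta 'X_i \is d.-homog.

Definition is_basis_D (K : fieldType) (n : nat) (A : multiarrangement K n)
    (theta1 theta2 : {mpoly K[2]} -> {mpoly K[2]}) : Prop :=
  [/\ in_D A theta1, in_D A theta2 &
      forall theta, in_D A theta ->
        exists! c : {mpoly K[2]} * {mpoly K[2]},
          forall p, theta p = c.1 * theta1 p + c.2 * theta2 p].

Definition is_exponents (K : fieldType) (n : nat) (A : multiarrangement K n)
    (e : nat * nat) : Prop :=
  (e.1 <= e.2)%N /\
  exists theta1 theta2, [/\ nonzero_homog e.1 theta1,
    nonzero_homog e.2 theta2 & is_basis_D A theta1 theta2].

(* Main.v *)
Require Import Defs.
From HB Require Import structures.
From mathcomp Require Import all_boot all_order all_algebra.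
From mathcomp Require Import reals complex mpoly ring.

Set Implicit Arguments.
Unset Strict Implicit.
Unset Printing Implicit Defensive.

Import GRing.Theory.
Local Open Scope ring_scope.

(** Write M for the sum of the multiplicities away from the dominant point
x = 0, m0 >= M for the multiplicity of that point, and Q1 for the product of
the powers of the other forms. Those forms are nonzero multiples of lines
y - c_i x with distinct slopes c_i, so a derivation theta = f d/dx + g d/dy
lies in D iff x^m0 divides f and (y - c_i x)^m_i divides g - c_i f for all i
([in_D_iff]).

Minimality. If f is nonzero, then theta has degree at least m0 >= M. If f = 0,
then each (y - c_i x)^m_i divides g; these powers are pairwise coprime, so Q1
divides g ([prod_lines_divides]) and the degree is again at least M, the degree
of Q1 d/dy.

Exponents. A second generator of degree m0 has the form x^m0 d/dx + h d/dy,
with h homogeneous of degree m0 and congruent to c_i x^m0 modulo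
(y - c_i x)^m_i for every i. Setting x = 1 turns this into a Chinese remainder
problem in K[y], which has a solution of degree less than M
([poly_interpolation]); as M <= m0, this solution can be homogenized in degree
m0 ([second_derivation]). The two derivations form a basis: subtracting a
multiple of the second from an element of D kills its d/dx component, and the
rest is a multiple of Q1 d/dy.

Uniqueness. Two bases of D have coefficient determinants that divide each other
(Saito's argument), so every homogeneous basis has e1 + e2 = M + m0. By
minimality e1 >= M. If e2 < m0, then both elements would have zero d/dx
component and the determinant would vanish; hence e2 >= m0, and
(e1, e2) = (M, m0). *)

(** * Divisibility and degree *)

Definition divides (R : comNzRingType) (p q : R) : Prop := exists r, q = p * r.

Lemma divides_add (R : comNzRingType) (p q r : R) :
  divides p q -> divides p r -> divides p (q + r).
Proof. by move=> [a ->] [b ->]; exists (a + b); rewrite mulrDr. Qed.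

Lemma divides_mull (R : comNzRingType) (p q r : R) :
  divides p q -> divides p (r * q).
Proof. by move=> [a ->]; exists (r * a); rewrite mulrCA. Qed.

Lemma divides_scale (K : fieldType) (n : nat) (b : K) (p q : {mpoly K[n]}) :
  divides p q -> divides p (b *: q).
Proof. by move=> [a ->]; exists (b *: a); rewrite scalerAr. Qed.

Lemma divides_scalel (K : fieldType) (n : nat) (b : K) (p q : {mpoly K[n]}) :
  b != 0 -> divides (b *: p) q <-> divides p q.
Proof.
move=> b0; split=> -[a ->].
  by exists (b *: a); rewrite -scalerAl scalerAr.
by exists (b^-1 *: a); rewrite -scalerAl -scalerAr scalerA divff // scale1r.
Qed.

Lemma divides_scaler (K : fieldType) (n : nat) (b : K) (p q : {mpoly K[n]}) :
  b != 0 -> divides p (b *: q) <-> divides p q.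
Proof.
move=> b0; split; last exact: divides_scale.
by move/(divides_scale b^-1); rewrite scalerA mulVf // scale1r.
Qed.

Lemma homog_degree_le (K : fieldType) (n d e : nat) (p q : {mpoly K[n]}) :
  p \is d.-homog -> q \is e.-homog -> q != 0 -> divides p q -> (d <= e)%N.
Proof.
move=> hp hq q0 [r qE].
have p0 : p != 0 by apply: contraNneq q0 => p0; rewrite qE p0 mul0r.
have r0 : r != 0 by apply: contraNneq q0 => r0; rewrite qE r0 mulr0.
rewrite (dhomog_uniq p0 hp (dhomog_msize hp)).
rewrite (dhomog_uniq q0 hq (dhomog_msize hq)).
rewrite qE msizeM // (mpolySpred _ r0) addnS -pred_Sn -!subn1.
by rewrite leq_sub2r // leq_addr.
Qed.

Lemma mpolyXn_homog (K : fieldType) (n : nat) (i : 'I_n) (k : nat) :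
  'X_i ^+ k \is [in K[n], k.-homog].
Proof.
have X1 : ('X_i : {mpoly K[n]}) \is 1.-homog.
  by rewrite dhomogX; apply/eqP; exact: mdeg1.
by have := dhomogMn k X1; rewrite mul1n.
Qed.

(** * Derivations of K[x,y] *)

Lemma mpoly_alg_ind (K : fieldType) (n : nat) (P : {mpoly K[n]} -> Prop) :
    (forall p q, P p -> P q -> P (p + q)) ->
    (forall c p, P p -> P (c *: p)) ->
    (forall p q, P p -> P q -> P (p * q)) ->
    P 1 -> (forall i, P 'X_i) ->
  forall p, P p.
Proof.
move=> PD PZ PM P1 PX; elim/mpolyind => [|c m p _ _ Pp].
  by rewrite -(scale0r 1); apply: PZ.
apply: (PD _ _ _ Pp); apply: PZ; rewrite mpolyXE_id.
elim/big_ind: _ => // i _; elim: (m i) => [|k IH]; first by rewrite expr0.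
by rewrite exprS; apply: PM.
Qed.

Lemma ord2_cases (i : 'I_2) : i = 0 \/ i = 1.
Proof. by case: i => [[|[|//]] ?]; [left|right]; apply: val_inj. Qed.

Definition der (K : fieldType) (f g p : {mpoly K[2]}) :=
  f * p^`M(0) + g * p^`M(1).

Lemma mderivU (K : fieldType) (n : nat) (i j : 'I_n) :
  ('X_i : {mpoly K[n]})^`M(j) = (i == j)%:R.
Proof.
rewrite mderivX mnm1E; case: eqP => [->|_]; last by rewrite scale0r.
rewrite scale1r -mpolyX0; congr 'X_[_].
by apply/mnmP=> k; rewrite mnmBE subnn mnm0E.
Qed.

Lemma derX0 (K : fieldType) (f g : {mpoly K[2]}) : der f g 'X_0 = f.
Proof. by rewrite /der !mderivU /= mulr1 mulr0 addr0. Qed.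

Lemma derX1 (K : fieldType) (f g : {mpoly K[2]}) : der f g 'X_1 = g.
Proof. by rewrite /der !mderivU /= mulr1 mulr0 add0r. Qed.

Lemma derivation_der (K : fieldType) (f g : {mpoly K[2]}) :
  derivation (der f g).
Proof.
split=> [a p q|p q]; rewrite /der.
  by rewrite !mderivD !mderivZ -!mul_mpolyC; ring.
by rewrite !mderivM; ring.
Qed.

Lemma derivation_form (K : fieldType) (theta : {mpoly K[2]} -> {mpoly K[2]}) :
  derivation theta ->
  forall b c p q, theta (b *: (p - c *: q)) = b *: (theta p - c *: theta q).
Proof.
move=> [lin _] b c p q.
have th0 : theta 0 = 0.
  by have := lin (-1) 0 0; rewrite scaler0 addr0 scaleN1r addNr.
have sc a r : theta (a *: r) = a *: theta r.
  by have := lin a r 0; rewrite th0 !addr0.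
by rewrite sc addrC -scaleNr lin scaleNr addrC.
Qed.

Lemma derivationE (K : fieldType) (theta : {mpoly K[2]} -> {mpoly K[2]}) :
  derivation theta -> theta =1 der (theta 'X_0) (theta 'X_1).
Proof.
move=> dth; have [lin leib] := dth.
have [lin' leib'] := derivation_der (theta 'X_0) (theta 'X_1).
have one (eta : {mpoly K[2]} -> {mpoly K[2]}) :
    (forall p q, eta (p * q) = eta p * q + p * eta q) -> eta 1 = 0.
  by move=> /(_ 1 1); rewrite !mulr1 mul1r -[LHS]addr0 => /addrI.
have add (eta : {mpoly K[2]} -> {mpoly K[2]}) : linear eta ->
    forall p q, eta (p + q) = eta p + eta q.
  by move=> h p q; have := h 1 p q; rewrite !scale1r.
apply: mpoly_alg_ind.
- by move=> p q hp hq; rewrite (add _ lin) (add _ lin') hp hq.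
- move=> c p hp; have := derivation_form dth c 0 p 0.
  have := derivation_form (derivation_der (theta 'X_0) (theta 'X_1)) c 0 p 0.
  by rewrite !scale0r !subr0 hp => -> ->.
- by move=> p q hp hq; rewrite leib leib' hp hq.
- by rewrite (one _ leib) (one _ leib').
move=> i; have [->|->] := ord2_cases i.
- by rewrite derX0.
- by rewrite derX1.
Qed.

(** * Coprimality of powers of distinct lines *)

(** The points other than x = 0 of the projective line are given by a slope. *)
Definition line (K : fieldType) (c : K) : {mpoly K[2]} := 'X_1 - c *: 'X_0.

(** Restriction to the line y = c x, that is, the substitution (x, c x): its
target is an integral domain, and [line_dividesE] identifies its kernel with
the multiples of y - c x, so that y - c x is a prime element. *)
Definition on_line (K : fieldType) (c : K) (p : {mpoly K[2]}) : {mpoly K[2]} :=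
  p \mPo [tuple 'X_0; c *: 'X_0].

Lemma on_lineM (K : fieldType) (c : K) : {morph on_line c : p q / p * q}.
Proof. by move=> p q; rewrite /on_line rmorphM. Qed.

Lemma on_line1 (K : fieldType) (c : K) : on_line c 1 = 1.
Proof. exact: comp_mpoly1. Qed.

Lemma on_lineXn (K : fieldType) (c : K) (m : nat) (p : {mpoly K[2]}) :
  on_line c (p ^+ m) = on_line c p ^+ m.
Proof. by elim: m => [|m IH]; rewrite ?on_line1 // !exprS on_lineM IH. Qed.

Lemma on_line_line (K : fieldType) (c d : K) :
  on_line c (line d) = (c - d) *: 'X_0.
Proof.
by rewrite /on_line /line comp_mpolyB comp_mpolyZ !comp_mpolyXU /= scalerBl.
Qed.

Lemma line_divides_sub (K : fieldType) (c : K) (p : {mpoly K[2]}) :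
  divides (line c) (p - on_line c p).
Proof.
elim/mpoly_alg_ind: p.
- move=> p q hp hq; rewrite /on_line comp_mpolyD opprD addrACA.
  exact: divides_add.
- move=> b p hp; rewrite /on_line comp_mpolyZ -scalerBr.
  exact: divides_scale.
- move=> p q hp hq; rewrite on_lineM.
  have -> : p * q - on_line c p * on_line c q =
    q * (p - on_line c p) + on_line c p * (q - on_line c q) by ring.
  by apply: divides_add; apply: divides_mull.
- by exists 0; rewrite /on_line comp_mpoly1 subrr mulr0.
move=> i; have [->|->] := ord2_cases i.
- by exists 0; rewrite /on_line comp_mpolyXU subrr mulr0.
- by exists 1; rewrite /on_line comp_mpolyXU mulr1.
Qed.

Lemma line_dividesE (K : fieldType) (c : K) (p : {mpoly K[2]}) :
  divides (line c) p <-> on_line c p = 0.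
Proof.
split=> [[r ->]|p0]; first by rewrite on_lineM on_line_line subrr scale0r mul0r.
by have := line_divides_sub c p; rewrite p0 subr0.
Qed.

Lemma mpolyX_neq0 (K : fieldType) (n : nat) (i : 'I_n) :
  ('X_i : {mpoly K[n]}) != 0.
Proof. by rewrite -msupp_eq0 msuppX. Qed.

Lemma line_neq0 (K : fieldType) (c : K) : line c != 0.
Proof.
apply/eqP=> /(congr1 (on_line (c + 1))); rewrite on_line_line.
rewrite addrAC subrr add0r scale1r /on_line comp_mpoly0 => /eqP.
exact/negP/mpolyX_neq0.
Qed.

(** A factor that does not vanish on the line can be cancelled one power of the
prime y - c x at a time. *)
Lemma line_exp_Gauss (K : fieldType) (c : K) (m : nat) (p q : {mpoly K[2]}) :
  on_line c p != 0 -> divides (line c ^+ m) (p * q) -> divides (line c ^+ m) q.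
Proof.
move=> p0; elim: m q => [|m IH] q; first by exists q; rewrite mul1r.
move=> [r pqE]; have [s qE] : divides (line c) q.
  apply/line_dividesE/eqP; have /eqP := congr1 (on_line c) pqE.
  rewrite exprS -mulrA !on_lineM on_line_line subrr scale0r mul0r.
  by rewrite mulf_eq0 (negbTE p0).
have [t sE] : divides (line c ^+ m) s.
  apply: IH; exists r; apply: (mulfI (line_neq0 c)).
  by rewrite [RHS]mulrA -exprS -pqE qE mulrCA.
by exists t; rewrite qE sE exprS mulrA.
Qed.

Lemma prod_lines_divides (K : fieldType) (n : nat) (c : 'I_n -> K)
    (m : 'I_n -> nat) (q : {mpoly K[2]}) : injective c ->
  (forall i, divides (line (c i) ^+ m i) q) ->
  divides (\prod_i line (c i) ^+ m i) q.
Proof.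
move=> c_inj dvd; rewrite -big_enum /=; have := enum_uniq 'I_n.
elim: (enum 'I_n) => [_|i s IH].
  by rewrite big_nil; exists q; rewrite mul1r.
rewrite /= => /andP[i_s /IH [r qE]]; rewrite big_cons.
have [t rE] : divides (line (c i) ^+ m i) r.
  apply: (@line_exp_Gauss _ _ _ (\prod_(j <- s) line (c j) ^+ m j));
    last by rewrite -qE.
  rewrite (big_morph _ (on_lineM _) (on_line1 _)) prodf_seq_neq0.
  apply/allP=> j js /=; rewrite on_lineXn on_line_line expf_neq0 //.
  rewrite scaler_eq0 (negbTE (mpolyX_neq0 _ _)) orbF.
  by rewrite subr_eq0 (inj_eq c_inj); apply: contraNneq i_s => ->.
by exists t; rewrite qE rE mulrCA mulrA.
Qed.

(** * Homogenization *)

(** x^d P(y / x), for P of degree at most d; the coefficients of P beyond d are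
dropped. *)
Definition homogenize (K : fieldType) (d : nat) (P : {poly K}) : {mpoly K[2]} :=
  \sum_(k < d.+1) P`_k *: ('X_0 ^+ (d - k) * 'X_1 ^+ k).

Lemma homogenize_homog (K : fieldType) (d : nat) (P : {poly K}) :
  homogenize d P \is d.-homog.
Proof.
apply: rpred_sum => k _; apply: dhomogZ.
have kd : (k <= d)%N by rewrite -ltnS.
have := dhomogM (mpolyXn_homog K (0 : 'I_2) (d - k)) (mpolyXn_homog K 1 k).
by rewrite subnK.
Qed.

Lemma homogenize_linear (K : fieldType) (d : nat) : linear (@homogenize K d).
Proof.
move=> a p q; rewrite /homogenize scaler_sumr -big_split /=.
apply: eq_bigr => k _.
by rewrite coefD coefZ scalerDl scalerA.
Qed.

Lemma homogenizeC (K : fieldType) (d : nat) (c : K) :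
  homogenize d c%:P = c *: 'X_0 ^+ d.
Proof.
rewrite /homogenize big_ord_recl coefC /= subn0 expr0 mulr1.
rewrite big1 ?addr0 // => k _.
by rewrite coefC /= scale0r.
Qed.

Lemma homogenizeB (K : fieldType) (d : nat) :
  {morph @homogenize K d : p q / p - q}.
Proof.
move=> p q; rewrite addrC -[- q]scaleN1r homogenize_linear.
by rewrite scaleN1r addrC.
Qed.

(** Homogenization is multiplicative as long as the degree bounds add up; the
bound on q keeps its top coefficient from being dropped. *)
Lemma homogenize_line (K : fieldType) (d : nat) (c : K) (q : {poly K}) :
  (size q <= d.+1)%N ->
  homogenize d.+1 (('X - c%:P) * q) = line c * homogenize d q.
Proof.
move=> sq; rewrite mulrBl homogenizeB /line mulrBl; congr (_ - _).
  rewrite /homogenize big_ord_recl coefXM /= scale0r add0r mulr_sumr.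
  apply: eq_bigr => k _; rewrite coefXM /= /bump /= add1n subSS exprS.
  by rewrite -scalerAr mulrCA.
rewrite mul_polyC /homogenize big_ord_recr /= coefZ nth_default //.
rewrite mulr0 scale0r addr0 mulr_sumr; apply: eq_bigr => k _.
have kd : (k <= d)%N by rewrite -ltnS.
rewrite coefZ (subSn kd) exprS -!mul_mpolyC mpolyCM; ring.
Qed.

Lemma homogenize_line_exp (K : fieldType) (d m : nat) (c : K) (q : {poly K}) :
  (size q <= d.+1)%N ->
  homogenize (m + d) (('X - c%:P) ^+ m * q) = line c ^+ m * homogenize d q.
Proof.
move=> sq; elim: m => [|m IH]; first by rewrite !mul1r.
rewrite addSn !exprS -!mulrA homogenize_line ?IH //.
rewrite (leq_trans (size_polyMleq _ _)) // size_exp_XsubC addSn /=.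
by rewrite -addnS leq_add2l.
Qed.

(** * Simultaneous congruences in one variable *)

Lemma poly_chinese (K : fieldType) (I : eqType) (s : seq I)
    (d r : I -> {poly K}) : uniq s ->
  {in s &, forall i j, i != j -> coprimep (d i) (d j)} ->
  exists H, {in s, forall i, d i %| H - r i}.
Proof.
elim: s => [|i s IH]; first by exists 0.
rewrite /= => /andP[i_s us] co.
have [j k js ks|H HE] := IH us; first by apply: co; rewrite inE ?js ?ks orbT.
have : coprimep (\prod_(j <- s) d j) (d i).
  rewrite big_seq; elim/big_ind: _ => [|p q hp hq|j js].
  - by rewrite coprime1p.
  - by rewrite coprimepMl hp hq.
  - apply: co; rewrite ?inE ?eqxx ?js ?orbT //.
    by apply: contraNneq i_s => <-.
move=> /Bezout_eq1_coprimepP[[u v] /= uv].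
(* u * prod d_j is 0 modulo every d_j and 1 modulo d_i. *)
exists (H + u * \prod_(j <- s) d j * (r i - H)) => j.
rewrite inE => /predU1P[->|js].
  have -> : H + u * \prod_(j <- s) d j * (r i - H) - r i = (H - r i) * v * d i.
    have -> : u * \prod_(j <- s) d j = 1 - v * d i by rewrite -[in RHS]uv addrK.
    by ring.
  exact: dvdp_mull.
rewrite addrAC dvdp_add ?HE // dvdp_mulr // dvdp_mull //.
by rewrite (big_rem j) //= dvdp_mulr.
Qed.

Lemma poly_interpolation (K : fieldType) (n : nat) (c : 'I_n -> K)
    (m : 'I_n -> nat) : injective c ->
  exists2 H : {poly K}, (size H <= \sum_i m i)%N &
    forall i, ('X - (c i)%:P) ^+ m i %| H - (c i)%:P.
Proof.
move=> c_inj; pose d i := ('X - (c i)%:P) ^+ m i.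
have [||H HE] := @poly_chinese K _ (enum 'I_n) d (fun i => (c i)%:P).
- exact: enum_uniq.
- move=> i j _ _ ij; apply: coprimep_expl; apply: coprimep_expr.
  by apply: coprimep_XsubC2; rewrite subr_eq0 (inj_eq c_inj) eq_sym.
pose P := \prod_i d i.
have P_size : size P = (\sum_i m i).+1.
  rewrite size_prod => [|i _]; last by rewrite expf_neq0 // polyXsubC_eq0.
  under eq_bigr do rewrite size_exp_XsubC.
  under eq_bigr do rewrite -addn1.
  rewrite big_split /= sum1_card.
  by rewrite -addSn addnK.
have P0 : P != 0 by rewrite -size_poly_gt0 P_size.
exists (H %% P); first by rewrite -ltnS -P_size ltn_modp.
move=> i; have -> : H %% P - (c i)%:P = (H - (c i)%:P) - H %/ P * P.
  by rewrite [X in _ = X - _ - _](divp_eq H P); ring.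
rewrite dvdp_sub ?HE ?mem_enum // dvdp_mull // /P (bigD1 i) //=.
exact: dvdp_mulr.
Qed.

(** * Arrangements with a dominant point *)

Section DominantPoint.

Variables (K : fieldType) (n : nat) (A : multiarrangement K n.+1).
Variables (b c : 'I_n -> K).
Hypothesis (b_neq0 : forall i, b i != 0) (c_inj : injective c).
Hypothesis form0 : lin_form A ord0 = 'X_0.
Hypothesis formS : forall i, lin_form A (lift ord0 i) = b i *: line (c i).

Local Notation m0 := (multiplicity A ord0).
Local Notation m i := (multiplicity A (lift ord0 i)).
Local Notation M := (\sum_i m i)%N.
Local Notation Q1 := (\prod_i lin_form A (lift ord0 i) ^+ m i).

Hypothesis dominant : (M <= m0)%N.

(** Replacing theta(alpha_i) by theta(y) - c_i theta(x) only loses the unit b_i,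
and the criterion depends only on the two components of theta. *)
Lemma in_D_iff (theta : {mpoly K[2]} -> {mpoly K[2]}) : derivation theta ->
  in_D A theta <-> divides ('X_0 ^+ m0) (theta 'X_0) /\
    forall i, divides (line (c i) ^+ m i) (theta 'X_1 - c i *: theta 'X_0).
Proof.
move=> dth.
have atS i :
    divides (lin_form A (lift ord0 i) ^+ m i) (theta (lin_form A (lift ord0 i)))
    <-> divides (line (c i) ^+ m i) (theta 'X_1 - c i *: theta 'X_0).
  rewrite formS derivation_form // exprZn.
  by rewrite divides_scalel ?expf_neq0 // divides_scaler.
split=> [[_ dvd]|[dvd0 dvdS]].
  split=> [|i]; first by have := dvd ord0; rewrite form0.
  exact/atS/dvd.
split=> // i; case: (unliftP ord0 i) => [j ->|->]; first exact/atS.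
by rewrite form0.
Qed.

Lemma X0m0_neq0 : 'X_0 ^+ m0 != 0 :> {mpoly K[2]}.
Proof. by rewrite expf_neq0 ?mpolyX_neq0. Qed.

Lemma X0m0_homog : 'X_0 ^+ m0 \is [in K[2], m0.-homog].
Proof. exact: mpolyXn_homog. Qed.

Lemma Q1_homog : Q1 \is M.-homog.
Proof.
elim/big_rec2: _ => [|i d p _ hp]; first exact: dhomog1.
apply: dhomogM => //.
by have := dhomogMn (m i) (lin_form_homog A (lift ord0 i)); rewrite mul1n.
Qed.

Lemma Q1_neq0 : Q1 != 0.
Proof. by apply/prodf_neq0 => i _; rewrite expf_neq0 ?lin_form_neq0. Qed.

(** Powers of lines with distinct slopes are coprime, so the conditions at the
separate points combine into one divisibility. *)
Lemma Q1_divides (q : {mpoly K[2]}) :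
  (forall i, divides (line (c i) ^+ m i) q) <-> divides Q1 q.
Proof.
have -> : Q1 = \prod_i b i ^+ m i *: \prod_i line (c i) ^+ m i.
  rewrite -scaler_prod; apply: eq_bigr => i _; by rewrite formS exprZn.
rewrite divides_scalel; last by apply/prodf_neq0 => i _; rewrite expf_neq0.
split=> [|[r ->] i]; first exact: prod_lines_divides.
exists (\prod_(j | j != i) line (c j) ^+ m j * r).
by rewrite (bigD1 i) //= mulrA.
Qed.

Lemma in_D_dy : in_D A (fun p => Q1 * p^`M(1)).
Proof.
have Q1E p : der 0 Q1 p = Q1 * p^`M(1) by rewrite /der mul0r add0r.
have dQ1 : derivation (fun p => Q1 * p^`M(1)).
  have [lin leib] := derivation_der 0 Q1.
  by split=> [a p q|p q] /=; rewrite -!Q1E; [apply: lin | apply: leib].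
apply/in_D_iff => //; rewrite -!Q1E derX0 derX1; split=> [|i].
  by exists 0; rewrite mulr0.
rewrite scaler0 subr0; move: i; apply/Q1_divides.
by exists 1; rewrite mulr1.
Qed.

Lemma in_D_dy_divides theta : in_D A theta -> theta 'X_0 = 0 ->
  divides Q1 (theta 'X_1).
Proof.
move=> Dth th0; have [_] := (in_D_iff Dth.1).1 Dth; rewrite th0 => dvd.
by apply/Q1_divides => i; have := dvd i; rewrite scaler0 subr0.
Qed.

(** Either the x-component is nonzero, and x^m0 forces degree m0 >= M, or it
vanishes, and Q1 divides the y-component. *)
Lemma in_D_degree_ge theta e :
  in_D A theta -> nonzero_homog e theta -> (M <= e)%N.
Proof.
move=> Dth [[p thp] hom]; have [dvd0 _] := (in_D_iff Dth.1).1 Dth.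
have [th0|th0] := eqVneq (theta 'X_0) 0; last first.
  exact: leq_trans dominant (homog_degree_le X0m0_homog (hom 0) th0 dvd0).
apply: homog_degree_le Q1_homog (hom 1) _ (in_D_dy_divides Dth th0).
apply: contraNneq thp => th1.
by rewrite (derivationE Dth.1) /der th0 th1 !mul0r addr0.
Qed.

Lemma dy_homog : nonzero_homog M (fun p => Q1 * p^`M(1)).
Proof.
split; first by exists 'X_1; rewrite mderivU mulr1 Q1_neq0.
move=> i; rewrite mderivU; case: eqP => _; rewrite ?mulr1 ?Q1_homog //.
by rewrite mulr0 dhomog0.
Qed.

(** The y-component solves h = c_i x^m0 modulo (y - c_i x)^m_i; the hypothesis
M <= m0 leaves room to homogenize a univariate solution in degree m0. *)
Lemma second_derivation :
  exists2 h, h \is m0.-homog & in_D A (der ('X_0 ^+ m0) h).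
Proof.
have [H sH HE] := poly_interpolation (fun i => m i) c_inj.
exists (homogenize m0 H); first exact: homogenize_homog.
apply/in_D_iff; first exact: derivation_der.
rewrite derX0 derX1; split=> [|i]; first by exists 1; rewrite mulr1.
rewrite -homogenizeC -homogenizeB.
have [q qE] := dvdpP _ _ (HE i).
have le_m : (m i <= m0)%N.
  by apply: leq_trans dominant; rewrite (bigD1 i) //= leq_addr.
(* The size of a product is only additive for nonzero factors. *)
have [q0|q0] := eqVneq q 0.
  by exists 0; rewrite qE q0 mul0r -[0]subr0 homogenizeB subrr mulr0.
exists (homogenize (m0 - m i) q); rewrite qE mulrC -{1}(subnKC le_m).
apply: homogenize_line_exp; rewrite -subSn //.
have : (size (H - (c i)%:P)%R <= m0.+1)%N.
  rewrite (leq_trans (size_polyD _ _)) // size_polyN geq_max.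
  rewrite (leq_trans sH) ?(leq_trans dominant) //.
  by rewrite (leq_trans (size_polyC_leq1 _)).
rewrite qE size_mul // ?expf_neq0 ?polyXsubC_eq0 // size_exp_XsubC addnS /=.
by rewrite leq_subRL ?(leqW le_m) // addnC.
Qed.

Section Exponents.

Variable h : {mpoly K[2]}.
Hypotheses (h_homog : h \is m0.-homog) (Dh : in_D A (der ('X_0 ^+ m0) h)).

(** Subtracting a times the second derivation, where theta(x) = a x^m0, leaves
an element of D with zero x-component, hence a multiple of Q1 d/dy. *)
Lemma in_D_coords theta : in_D A theta -> exists g a : {mpoly K[2]},
  theta 'X_0 = a * 'X_0 ^+ m0 /\ theta 'X_1 = g * Q1 + a * h.
Proof.
move=> Dth; have [[a aE] dvd] := (in_D_iff Dth.1).1 Dth.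
have [_] := (in_D_iff Dh.1).1 Dh; rewrite derX0 derX1 => dvdh.
have [|g gE] := (Q1_divides (theta 'X_1 - a * h)).1.
  move=> i; have -> : theta 'X_1 - a * h = (theta 'X_1 - c i *: theta 'X_0)
     + - a * (h - c i *: 'X_0 ^+ m0).
    rewrite aE -!mul_mpolyC; ring.
  by apply: divides_add => //; apply: divides_mull.
exists g, a; split; first by rewrite aE mulrC.
by rewrite [g * _]mulrC -gE subrK.
Qed.

Lemma is_exponents_dominant : is_exponents A (M, m0).
Proof.
split=> //; exists (fun p => Q1 * p^`M(1)), (der ('X_0 ^+ m0) h); split.
- exact: dy_homog.
- split; first by exists 'X_0; rewrite derX0 X0m0_neq0.
  move=> i; have [->|->] := ord2_cases i.
  - by rewrite derX0; exact: X0m0_homog.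
  - by rewrite derX1.
split=> //; first exact: in_D_dy.
move=> theta Dth; have [g [a [th0 th1]]] := in_D_coords Dth.
exists (g, a); split=> [p|[g' a'] /= E].
  by rewrite (derivationE Dth.1) /der th0 th1 /=; ring.
have /(mulIf X0m0_neq0) aE : a * 'X_0 ^+ m0 = a' * 'X_0 ^+ m0.
  by rewrite -th0 E derX0 mderivU mulr0 mulr0 add0r.
congr (_, _) => //; apply: (mulIf Q1_neq0); apply: (addIr (a * h)).
by rewrite -th1 E derX1 mderivU mulr1 aE.
Qed.

Definition det (eta1 eta2 : {mpoly K[2]} -> {mpoly K[2]}) : {mpoly K[2]} :=
  eta1 'X_0 * eta2 'X_1 - eta1 'X_1 * eta2 'X_0.

(** The determinants of the given basis and of the basis above divide each
other, which fixes e1 + e2; the individual degrees follow since two elements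
with zero x-component have zero determinant. *)
Lemma is_exponents_unique e : is_exponents A e -> e = (M, m0).
Proof.
case: e => e1 e2 [/= le12 [eta1 [eta2 [nz1 nz2 [D1 D2 gen]]]]].
have homdet : det eta1 eta2 \is (e1 + e2).-homog.
  by apply: rpredB; apply: dhomogM; first [apply: nz1.2|apply: nz2.2].
have [g1 [a1 [x1 y1]]] := in_D_coords D1.
have [g2 [a2 [x2 y2]]] := in_D_coords D2.
have detE : det eta1 eta2 = 'X_0 ^+ m0 * Q1 * (a1 * g2 - g1 * a2).
  by rewrite /det x1 x2 y1 y2; ring.
have [[u1 u2] [/= uE _]] := gen _ in_D_dy.
have [[v1 v2] [/= vE _]] := gen _ Dh.
have Edet : 'X_0 ^+ m0 * Q1 = det eta1 eta2 * (u2 * v1 - u1 * v2).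
  have := uE 'X_0; rewrite mderivU mulr0 => ux.
  have := uE 'X_1; rewrite mderivU mulr1 => uy.
  have := vE 'X_0; rewrite derX0 => vx.
  have -> : 'X_0 ^+ m0 * Q1 = Q1 * 'X_0 ^+ m0 - 0 * h by ring.
  have := vE 'X_1; rewrite derX1 => vy.
  by rewrite ux uy vx vy /det; ring.
have XQ0 : 'X_0 ^+ m0 * Q1 != 0 by rewrite mulf_neq0 ?X0m0_neq0 ?Q1_neq0.
have det0 : det eta1 eta2 != 0.
  by apply: contraNneq XQ0 => d0; rewrite Edet d0 mul0r.
have homXQ : 'X_0 ^+ m0 * Q1 \is (m0 + M).-homog.
  exact: dhomogM X0m0_homog Q1_homog.
have sumE : (e1 + e2 = m0 + M)%N.
  apply/eqP; rewrite eqn_leq (homog_degree_le homdet homXQ) //;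
    last by eexists; exact: Edet.
  by rewrite (homog_degree_le homXQ homdet) //; eexists; exact: detE.
have small eta e : in_D A eta -> nonzero_homog e eta ->
    (e < m0)%N -> eta 'X_0 = 0.
  move=> Deta [_ hometa]; rewrite ltnNge => /negP lt_em.
  apply/eqP/negPn/negP => eta0; apply: lt_em.
  apply: homog_degree_le X0m0_homog (hometa 0) eta0 _.
  by have [] := (in_D_iff Deta.1).1 Deta.
have e2_ge : (m0 <= e2)%N.
  rewrite leqNgt; apply/negP => lt2; case/eqP: det0.
  have lt1 := leq_ltn_trans le12 lt2.
  rewrite /det (small _ _ D2 nz2 lt2) (small _ _ D1 nz1 lt1).
  by rewrite mul0r mulr0 subrr.
have e1_ge := in_D_degree_ge D1 nz1.
have e2E : e2 = m0.
  apply/eqP; rewrite eqn_leq e2_ge andbT -(leq_add2l e1) sumE addnC.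
  by rewrite leq_add2r.
by move: sumE; rewrite e2E addnC => /addnI ->.
Qed.

End Exponents.

End DominantPoint.

Theorem mainTheorem2 (R : realType) (n : nat)
    (A : multiarrangement R[i] n.+2) (z : 'I_n -> R[i])
    (z_neq0 : forall j, z j != 0)
    (z_inj : injective z)
    (form1 : lin_form A ord0 = 'X_0)
    (form2 : lin_form A (lift ord0 ord0) = 'X_1)
    (formz : forall j : 'I_n, lin_form A (rshift 2 j) = 'X_0 - z j *: 'X_1)
    (mult_decr : forall i j : 'I_n.+2, (i <= j)%N -> (multiplicity A j <= multiplicity A i)%N)
    (mult1_ge : (\sum_(i < n.+2 | i != ord0) multiplicity A i <= multiplicity A ord0)%N) :
  (exists Q1 : {mpoly R[i][2]},
     defining_poly A = 'X_0 ^+ multiplicity A ord0 * Q1 /\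
     let theta1 := fun p : {mpoly R[i][2]} => Q1 * p^`M(1) in
     in_D A theta1 /\
     exists d : nat, nonzero_homog d theta1 /\
       forall theta e, in_D A theta -> nonzero_homog e theta -> (d <= e)%N) /\
  (forall e : nat * nat, is_exponents A e <->
     e = (\sum_(i < n.+2 | i != ord0) multiplicity A i, multiplicity A ord0)%N).
Proof.
(* x - z y = - z (y - z^-1 x), and the form y has slope 0. *)
pose b (i : 'I_n.+1) := if unlift ord0 i is Some j then - z j else 1.
pose c (i : 'I_n.+1) := if unlift ord0 i is Some j then (z j)^-1 else 0.
have b_neq0 i : b i != 0.
  by rewrite /b; case: (unlift _ _) => [j|]; rewrite ?oppr_eq0 ?oner_eq0.
have c_inj : injective c.
  move=> i j; rewrite /c.
  case: (unliftP ord0 i) => [i' ->|->];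
    case: (unliftP ord0 j) => [j' ->|->] //.
  - by move/invr_inj/z_inj ->.
  - by move/eqP; rewrite invr_eq0 (negbTE (z_neq0 _)).
  - by move/esym/eqP; rewrite invr_eq0 (negbTE (z_neq0 _)).
have formS i : lin_form A (lift ord0 i) = b i *: line (c i).
  rewrite /b /c /line; case: (unliftP ord0 i) => [j ->|->]; last first.
    by rewrite scale0r subr0 scale1r.
  have -> : lift ord0 (lift ord0 j) = rshift 2 j by apply: val_inj.
  by rewrite formz scalerBr scalerA mulNr divff // scaleN1r opprK scaleNr addrC.
have sumE : (\sum_(i < n.+2 | i != ord0) multiplicity A i
    = \sum_(i < n.+1) multiplicity A (lift ord0 i))%N.
  by rewrite big_mkcond [LHS]big_ord_recl /= add0n.
rewrite sumE in mult1_ge *; split; last first.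
  have [h h_homog Dh] := second_derivation b_neq0 c_inj form1 formS mult1_ge.
  move=> e; split=> [|->].
    exact: (is_exponents_unique b_neq0 c_inj form1 formS mult1_ge Dh).
  exact: (is_exponents_dominant b_neq0 c_inj form1 formS mult1_ge h_homog Dh).
exists (\prod_i lin_form A (lift ord0 i) ^+ multiplicity A (lift ord0 i)).
split.
  by rewrite /defining_poly big_ord_recl form1.
split; first exact: (in_D_dy b_neq0 c_inj form1 formS).
eexists; split; first exact: dy_homog.
exact: (in_D_degree_ge b_neq0 c_inj form1 formS mult1_ge).
Qed.
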